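(* Let $\Gamma$ be a finite group and $\sigma \colon \Gamma \to \Gamma$ an involution (a group automorphism with $\sigma^2=\mathrm{id}$). Let $B\Gamma = [\Gamma \rightrightarrows \mathrm{pt}]$ be the classifying groupoid of $\Gamma$, endowed with the involution induced by $\sigma$. Then $$\dim \mathrm H^\ast( |(B\Gamma)^{G}|, \mathbb Z/2) \leq \dim \mathrm H^\ast( |\mathcal I_{B\Gamma}|, \mathbb Z/2).$$
   Context: $G\cong\mathbb Z/2$ is the group acting through the involution. $B\Gamma=[\Gamma\rightrightarrows\mathrm{pt}]$ is the topological groupoid with one object, with the discrete group $\Gamma$ as its space of arrows, and with composition given by multiplication. $\mathrm H^\ast$ denotes total cohomology $\bigoplus_i \mathrm H^i$. For a topological groupoid $\mathscr X=[R\rightrightarrows U]$ with involution $\sigma$ (compatible involutions of $U$ and $R$), the fixed locus is $$|\mathscr X^G|=\{(x,\varphi)\in U\times R : \varphi\colon x\to\sigma(x),\ \sigma(\varphi)\circ\varphi=\mathrm{id}\}/_{\cong},$$ where $(x,\varphi)\cong(y,\psi)$ if there is an arrow $f\colon x\to y$ in $R$ with $\psi\circ f=\sigma(f)\circ\varphi$, with the quotient topology. The inertia groupoid $\mathcal I_{\mathscr X}$ has as objects the space of arrows $\varphi\in R$ with $s(\varphi)=t(\varphi)$, and as morphisms $\varphi\to\varphi'$ the arrows $f\colon s(\varphi)\to s(\varphi')$ in $R$ with $\varphi'\circ f=f\circ\varphi$; $|\mathcal I_{\mathscr X}|$ is the set of isomorphism classes of its objects with the quotient topology. *)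

(* Defs.v *)
From HB Require Import structures.
From mathcomp Require Import all_boot all_order all_algebra all_fingroup.
From mathcomp Require Import generic_quotient ring_quotient.
From mathcomp Require Import all_classical all_reals all_analysis.

Set Implicit Arguments.
Unset Strict Implicit.
Unset Printing Implicit Defensive.

Import Order.TTheory GRing.Theory Num.Theory numFieldNormedType.Exports.
Export Quotient.Exports.

Local Open Scope classical_set_scope.
Local Open Scope ring_scope.
Local Open Scope quotient_scope.

Section quotient_module.
Context {k : fieldType} {V : lmodType k} (W : submodClosed V).

(* [submodClosed] does not inherit from the [zmodClosed] that [Quotient.quot]
   requires. *)
Definition submod_pred : {pred V} := W.

Let submod_pred_closed : zmod_closed submod_pred.
Proof. exact: (GRing.submodClosedP W). Qed.

HB.instance Definition _ := GRing.isZmodClosed.Build V submod_pred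
  submod_pred_closed.

Definition quot_module := Quotient.quot submod_pred.
HB.instance Definition _ := GRing.Zmodule.on quot_module.

Definition quot_scale (a : k) : quot_module -> quot_module :=
  lift_op1 quot_module (fun v => a *: v).

Lemma pi_quot_scale a (v : V) :
  \pi_quot_module (a *: v) = quot_scale a (\pi_quot_module v).
Proof.
have W0 : v - repr (\pi_quot_module v) \in submod_pred.
  by rewrite Quotient.idealrBE reprK.
rewrite /quot_scale; unlock; apply/eqP; rewrite -Quotient.idealrBE -scalerBr.
exact: (@rpredZ k V W).
Qed.

Lemma quot_scaleA a b x : quot_scale a (quot_scale b x) = quot_scale (a * b) x.
Proof. by rewrite -[x]reprK -!pi_quot_scale scalerA. Qed.

Lemma quot_scale1 : left_id 1 quot_scale.
Proof. by move=> x; rewrite -[x]reprK -pi_quot_scale scale1r. Qed.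

Lemma pi_quot_add (u v : V) :
  \pi_quot_module (u + v) = \pi_quot_module u + \pi_quot_module v.
Proof. exact: Quotient.pi_add. Qed.

Lemma quot_scaleDr : right_distributive quot_scale +%R.
Proof.
move=> a x y; rewrite -[x]reprK -[y]reprK -pi_quot_add -!pi_quot_scale.
by rewrite -pi_quot_add scalerDr.
Qed.

Lemma quot_scaleDl x : {morph quot_scale^~ x : a b / a + b}.
Proof.
by move=> a b; rewrite -[x]reprK -!pi_quot_scale -pi_quot_add scalerDl.
Qed.

HB.instance Definition _ := GRing.Zmodule_isLmodule.Build k quot_module
  quot_scaleA quot_scale1 quot_scaleDr quot_scaleDl.

End quotient_module.

Section direct_sum.
Context {k : fieldType} (V : nat -> lmodType k).

Definition direct_prod := forall i, V i.

HB.instance Definition _ := gen_eqMixin direct_prod.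
HB.instance Definition _ := gen_choiceMixin direct_prod.

Implicit Types u v w : direct_prod.

Definition prod_zero : direct_prod := fun=> 0.
Definition prod_opp u : direct_prod := fun i => - u i.
Definition prod_add u v : direct_prod := fun i => u i + v i.
Definition prod_scale (a : k) u : direct_prod := fun i => a *: u i.

Let prod_ext u v : (forall i, u i = v i) -> u = v.
Proof. exact: functional_extensionality_dep. Qed.

Let prod_addA : associative prod_add.
Proof. by move=> u v w; apply: prod_ext => i; exact: addrA. Qed.
Let prod_addC : commutative prod_add.
Proof. by move=> u v; apply: prod_ext => i; exact: addrC. Qed.
Let prod_add0 : left_id prod_zero prod_add.
Proof. by move=> u; apply: prod_ext => i; exact: add0r. Qed.
Let prod_addN : left_inverse prod_zero prod_opp prod_add.
Proof. by move=> u; apply: prod_ext => i; exact: addNr. Qed.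

HB.instance Definition _ :=
  GRing.isZmodule.Build direct_prod prod_addA prod_addC prod_add0 prod_addN.

Let prod_scaleA a b u : prod_scale a (prod_scale b u) = prod_scale (a * b) u.
Proof. by apply: prod_ext => i; exact: scalerA. Qed.
Let prod_scale1 : left_id 1 prod_scale.
Proof. by move=> u; apply: prod_ext => i; exact: scale1r. Qed.
Let prod_scaleDr : right_distributive prod_scale +%R.
Proof. by move=> a u v; apply: prod_ext => i; exact: scalerDr. Qed.
Let prod_scaleDl u : {morph prod_scale^~ u : a b / a + b}.
Proof. by move=> a b; apply: prod_ext => i; exact: scalerDl. Qed.

HB.instance Definition _ := GRing.Zmodule_isLmodule.Build k direct_prod
  prod_scaleA prod_scale1 prod_scaleDr prod_scaleDl.

Definition finite_support : {pred direct_prod} :=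
  fun u => `[< exists N, forall i, (N <= i)%N -> u i = 0 >].

Lemma finite_support_submod : submod_closed finite_support.
Proof.
split=> [|a u v /asboolP[N uN] /asboolP[M vM]]; apply/asboolP.
  by exists 0%N.
exists (maxn N M) => i; rewrite geq_max => /andP[Ni Mi].
change (a *: u i + v i = 0).
by rewrite uN // vM // scaler0 add0r.
Qed.

HB.instance Definition _ :=
  GRing.isSubmodClosed.Build k direct_prod finite_support finite_support_submod.

Record direct_sum := DirectSum {
  dsum_val :> direct_prod; dsum_valP : dsum_val \in finite_support }.

HB.instance Definition _ := [isSub for dsum_val].
HB.instance Definition _ := [Choice of direct_sum by <:].
HB.instance Definition _ := [SubChoice_isSubLmodule of direct_sum by <:].

End direct_sum.

Definition is_basis (k : fieldType) (V : lmodType k) n (b : 'I_n -> V) :=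
  (forall a : 'I_n -> k, \sum_i a i *: b i = 0 -> forall i, a i = 0) /\
  (forall v, exists a : 'I_n -> k, v = \sum_i a i *: b i).

Lemma leq_basis (k : fieldType) (V : lmodType k) n m
    (b : 'I_n -> V) (c : 'I_m -> V) : is_basis b -> is_basis c -> (n <= m)%N.
Proof.
move=> [bfree _] [_ /(_ (b _)) /cid cspan].
pose A := \matrix_(i, j) sval (cspan i) j.
have bE i : b i = \sum_j A i j *: c j.
  by rewrite (svalP (cspan i)); apply: eq_bigr => j _; rewrite mxE.
have -> : n = \rank A; last exact: rank_leq_col.
apply/esym/eqP/row_freeP; exists (pinvmx A); apply: mulmxVp.
apply/inj_row_free => u uA; apply/rowP => i; rewrite mxE; apply: bfree.
rewrite (eq_bigr (fun i => \sum_j (u 0 i * A i j) *: c j)); last first.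
  by move=> l _; rewrite bE scaler_sumr; apply: eq_bigr => j _; rewrite scalerA.
rewrite exchange_big big1 // => j _; rewrite -scaler_suml.
by move/rowP/(_ j): uA; rewrite !mxE => ->; rewrite scale0r.
Qed.

(* By [leq_basis] all finite bases have the same size, so this is the infimum
   of a singleton in finite dimension, and ereal_inf set0 = +oo otherwise. *)
Definition vdim (R : realType) (k : fieldType) (V : lmodType k) : \bar R :=
  ereal_inf [set n%:R%:E | n in [set n | exists b : 'I_n -> V, is_basis b]].

Section singular.
Context (R : realType).

Definition simplex n : set 'rV[R]_n.+1 :=
  [set t | (forall i, 0 <= t 0 i) /\ \sum_i t 0 i = 1].

Definition face_map n (i : 'I_n.+2) (t : 'rV[R]_n.+1) : 'rV[R]_n.+2 :=
  \row_j if unlift i j is Some j' then t 0 j' else 0.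

Arguments simplex : clear implicits.

Lemma face_map_simplex n (i : 'I_n.+2) t :
  simplex n t -> simplex n.+1 (face_map i t).
Proof.
move=> [t0 t1]; split=> [j|]; first by rewrite mxE; case: unliftP => [j'|] _.
rewrite (bigD1_ord i) //= mxE unlift_none add0r -[RHS]t1.
by apply: eq_bigr => j _; rewrite mxE liftK.
Qed.

Definition face n (i : 'I_n.+2) (t : simplex n) : simplex n.+1 :=
  SigSub (mem_set (face_map_simplex i (set_mem (valP t)))).

Lemma face_map_continuous n (i : 'I_n.+2) : continuous (@face_map n i).
Proof.
move=> t A [P tP PA].
exists (fun r j => P r (lift i j)).
  by move=> r j; move: (tP r (lift i j)); rewrite mxE liftK ord1.
move=> u Pu; apply: PA => r j; rewrite mxE.
case: unliftP => [j' ->|ji]; first by move: (Pu r j'); rewrite ord1.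
move: (tP r j); rewrite mxE -ji unlift_none; exact: nbhs_singleton.
Qed.

Lemma face_continuous n (i : 'I_n.+2) : continuous (face i).
Proof.
apply/continuousP => _ [B oB <-].
rewrite /open /=; exists (face_map i @^-1` B) => //.
by move/continuousP: (@face_map_continuous n i); apply.
Qed.

HB.instance Definition _ n (i : 'I_n.+2) :=
  isContinuous.Build _ _ (face i) (@face_continuous n i).

Context (k : fieldType) (X : topologicalType).

Definition singular_simplex n := continuousType (simplex n) X.

Definition cochain n := singular_simplex n -> k^o.
HB.instance Definition _ n := GRing.Lmodule.on (cochain n).

Definition coboundary n (c : cochain n) : cochain n.+1 :=
  fun s => \sum_(i < n.+2) (-1) ^+ i * c (s \o face i).

Lemma coboundary_linear n : linear (@coboundary n).
Proof.
move=> a c d; apply/funext => s.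
transitivity (a * coboundary c s + coboundary d s : k); last by [].
rewrite /coboundary mulr_sumr -big_split /=; apply: eq_bigr => i _.
by rewrite mulrCA -mulrDr.
Qed.

HB.instance Definition _ n :=
  GRing.isLinear.Build k (cochain n) (cochain n.+1) _ _ (@coboundary_linear n).

Definition is_cocycle n : {pred cochain n} := fun c => coboundary c == 0.

Lemma is_cocycle_submod n : submod_closed (@is_cocycle n).
Proof.
split=> [|a c d /eqP c0 /eqP d0]; apply/eqP; first exact: raddf0.
by rewrite coboundary_linear c0 d0 scaler0 addr0.
Qed.

HB.instance Definition _ n :=
  GRing.isSubmodClosed.Build k (cochain n) (@is_cocycle n)
    (@is_cocycle_submod n).

Record cocycle n := Cocycle {
  cocycle_val :> cochain n; cocycle_valP : cocycle_val \in @is_cocycle n }.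

HB.instance Definition _ n := [isSub for @cocycle_val n].
HB.instance Definition _ n := [Choice of cocycle n by <:].
HB.instance Definition _ n := [SubChoice_isSubLmodule of cocycle n by <:].

Definition is_coboundary n : {pred cocycle n} :=
  match n with
  | 0 => fun c => c == 0
  | m.+1 => fun c => `[< exists b : cochain m, val c = coboundary b >]
  end.

Lemma is_coboundary_submod n : submod_closed (@is_coboundary n).
Proof.
case: n => [|n]; split.
- exact: eqxx.
- by move=> a c d /eqP-> /eqP->; rewrite scaler0 addr0; apply: eqxx.
- by apply/asboolP; exists 0; rewrite !raddf0.
- move=> a c d /asboolP[b cb] /asboolP[e de]; apply/asboolP.
  exists (a *: b + e); rewrite coboundary_linear -cb -de; exact: linearP.
Qed.

HB.instance Definition _ n := GRing.isSubmodClosed.Build k (cocycle n)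
  (@is_coboundary n) (@is_coboundary_submod n).

Definition singular_cohomology n : lmodType k := quot_module (@is_coboundary n).

Definition total_cohomology : lmodType k := direct_sum singular_cohomology.

End singular.

(* [gcomp g f] is the composite g o f; it is meaningful only when
   [gsrc g = gtgt f], and unconstrained otherwise. *)
Record topGroupoid := TopGroupoid {
  gobj : topologicalType;
  garr : topologicalType;
  gsrc : garr -> gobj;
  gtgt : garr -> gobj;
  gid : gobj -> garr;
  ginv : garr -> garr;
  gcomp : garr -> garr -> garr;
  gsrc_id : forall x, gsrc (gid x) = x;
  gtgt_id : forall x, gtgt (gid x) = x;
  gsrc_inv : forall f, gsrc (ginv f) = gtgt f;
  gtgt_inv : forall f, gtgt (ginv f) = gsrc f;
  gsrc_comp : forall g f, gsrc g = gtgt f -> gsrc (gcomp g f) = gsrc f;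
  gtgt_comp : forall g f, gsrc g = gtgt f -> gtgt (gcomp g f) = gtgt g;
  gcompA : forall h g f, gsrc h = gtgt g -> gsrc g = gtgt f ->
    gcomp h (gcomp g f) = gcomp (gcomp h g) f;
  gcomp_idl : forall f, gcomp (gid (gtgt f)) f = f;
  gcomp_idr : forall f, gcomp f (gid (gsrc f)) = f;
  gcomp_invl : forall f, gcomp (ginv f) f = gid (gsrc f);
  gcomp_invr : forall f, gcomp f (ginv f) = gid (gtgt f);
  gsrc_continuous : continuous gsrc;
  gtgt_continuous : continuous gtgt;
  gid_continuous : continuous gid;
  ginv_continuous : continuous ginv;
  gcomp_continuous : {within [set p : garr * garr | gsrc p.1 = gtgt p.2],
    continuous (fun p => gcomp p.1 p.2)} }.

Record involution (X : topGroupoid) := Involution {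
  iobj : gobj X -> gobj X;
  iarr : garr X -> garr X;
  iobjK : involutive iobj;
  iarrK : involutive iarr;
  gsrc_iarr : forall f, gsrc (iarr f) = iobj (gsrc f);
  gtgt_iarr : forall f, gtgt (iarr f) = iobj (gtgt f);
  iarr_id : forall x, iarr (gid x) = gid (iobj x);
  iarr_comp : forall g f, gsrc g = gtgt f ->
    iarr (gcomp g f) = gcomp (iarr g) (iarr f);
  iobj_continuous : continuous iobj;
  iarr_continuous : continuous iarr }.

Section commuting_squares.
Context (X : topGroupoid).
Implicit Types a b c f g : garr X.

Lemma gcomp_square_inv a b f g :
  gsrc a = gsrc f -> gtgt f = gsrc b -> gtgt a = gsrc g -> gtgt g = gtgt b ->
  gcomp b f = gcomp g a -> gcomp a (ginv f) = gcomp (ginv g) b.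
Proof.
move=> af fb ag gb bfga.
have -> : a = gcomp (ginv g) (gcomp b f).
  by rewrite bfga gcompA ?gsrc_inv // gcomp_invl -ag gcomp_idl.
rewrite -gcompA ?gsrc_inv ?gtgt_inv ?gsrc_comp ?gtgt_comp //.
by rewrite -gcompA ?gtgt_inv // gcomp_invr fb gcomp_idr.
Qed.

Lemma gcomp_square_comp a b c f g f' g' :
  gsrc a = gsrc f -> gtgt f = gsrc b -> gtgt a = gsrc g -> gtgt g = gtgt b ->
  gsrc f' = gsrc b -> gtgt f' = gsrc c -> gsrc g' = gtgt b ->
  gcomp b f = gcomp g a -> gcomp c f' = gcomp g' b ->
  gcomp c (gcomp f' f) = gcomp (gcomp g' g) a.
Proof.
move=> af fb ag gb f'b f'c g'b bfga cf'.
by rewrite gcompA ?f'b // cf' -gcompA // bfga gcompA // g'b.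
Qed.

Lemma iarr_inv (s : involution X) f : iarr s (ginv f) = ginv (iarr s f).
Proof.
have H : gcomp (iarr s (ginv f)) (iarr s f) = gid (gsrc (iarr s f)).
  by rewrite -iarr_comp ?gsrc_inv // gcomp_invl iarr_id gsrc_iarr.
rewrite -[LHS]gcomp_idr gsrc_iarr gsrc_inv -gtgt_iarr -gcomp_invr gcompA;
  rewrite ?gtgt_inv ?gsrc_iarr ?gtgt_iarr ?gsrc_inv //.
by rewrite H -gtgt_inv gcomp_idl.
Qed.

End commuting_squares.

Section fixed_locus.
Context (X : topGroupoid) (s : involution X).

Definition fixed_objects : set (gobj X * garr X) :=
  [set p | [/\ gsrc p.2 = p.1, gtgt p.2 = iobj s p.1 &
              gcomp (iarr s p.2) p.2 = gid p.1]].

Definition fixed_iso (p q : fixed_objects) : bool :=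
  `[< exists f : garr X, [/\ gsrc f = (val p).1, gtgt f = (val q).1 &
        gcomp (val q).2 f = gcomp (iarr s f) (val p).2] >].

Lemma fixed_iso_equiv : equiv_class_of fixed_iso.
Proof.
have tr : transitive fixed_iso.
  move=> q p r; have [sq tq _] := set_mem (valP q).
  have [sp tp _] := set_mem (valP p); have [sr tr _] := set_mem (valP r).
  move=> /asboolP[f [sf tf pq]] /asboolP[g [sg tg qr]]; apply/asboolP.
  exists (gcomp g f); rewrite gsrc_comp ?gtgt_comp ?tf ?sg //; split=> //.
  rewrite iarr_comp ?tf ?sg //; apply: gcomp_square_comp pq qr => //;
    by rewrite ?gsrc_iarr ?gtgt_iarr ?(sp, tp, sq, tq, sr, tr, sf, tf, sg, tg).
have sy p q : fixed_iso p q -> fixed_iso q p.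
  have [sq tq _] := set_mem (valP q); have [sp tp _] := set_mem (valP p).
  move=> /asboolP[f [sf tf pq]]; apply/asboolP; exists (ginv f).
  rewrite gsrc_inv gtgt_inv; split=> //; rewrite iarr_inv.
  by apply: gcomp_square_inv pq;
    rewrite ?gsrc_iarr ?gtgt_iarr ?(sp, tp, sq, tq, sf, tf).
split=> [p||//]; last by move=> p q; apply/idP/idP; exact: sy.
have [sp tp _] := set_mem (valP p).
apply/asboolP; exists (gid (val p).1); rewrite gsrc_id gtgt_id; split=> //.
by rewrite iarr_id -tp gcomp_idl -sp gcomp_idr.
Qed.

Canonical fixed_iso_equivRel := EquivRelPack fixed_iso_equiv.

Definition fixed_locus : topologicalType :=
  quotient_topology {eq_quot fixed_iso}.

End fixed_locus.

Section inertia.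
Context (X : topGroupoid).

Definition inertia_objects : set (garr X) := [set phi | gsrc phi = gtgt phi].

Definition inertia_iso (phi psi : inertia_objects) : bool :=
  `[< exists f : garr X, [/\ gsrc f = gsrc (val phi), gtgt f = gsrc (val psi) &
        gcomp (val psi) f = gcomp f (val phi)] >].

Lemma inertia_iso_equiv : equiv_class_of inertia_iso.
Proof.
have tr : transitive inertia_iso.
  move=> q p r; have lq : gsrc (val q) = _ := set_mem (valP q).
  have lp : gsrc (val p) = _ := set_mem (valP p).
  move=> /asboolP[f [sf tf pq]] /asboolP[g [sg tg qr]]; apply/asboolP.
  exists (gcomp g f); rewrite gsrc_comp ?gtgt_comp ?tf ?sg //; split=> //.
  by apply: gcomp_square_comp pq qr; rewrite // -?lp -?lq ?sf ?tf ?sg.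
have sy p q : inertia_iso p q -> inertia_iso q p.
  have lq : gsrc (val q) = _ := set_mem (valP q).
  have lp : gsrc (val p) = _ := set_mem (valP p).
  move=> /asboolP[f [sf tf pq]]; apply/asboolP; exists (ginv f).
  rewrite gsrc_inv gtgt_inv; split=> //.
  by apply: gcomp_square_inv pq; rewrite // -?lp -?lq ?sf ?tf.
split=> [p||//]; last by move=> p q; apply/idP/idP; exact: sy.
have lp : gsrc (val p) = _ := set_mem (valP p).
apply/asboolP; exists (gid (gsrc (val p))); rewrite gsrc_id gtgt_id; split=> //.
by rewrite gcomp_idr [in RHS]lp gcomp_idl.
Qed.

Canonical inertia_iso_equivRel := EquivRelPack inertia_iso_equiv.

Definition inertia_space : topologicalType :=
  quotient_topology {eq_quot inertia_iso}.

End inertia.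

Lemma discrete_continuous (T : choiceType) (Y : topologicalType)
  (f : discrete_topology T -> Y) : continuous f.
Proof. by apply/continuousP => A _; exact: discrete_open. Qed.

Section classifying.
Context (G : groupType).

Definition classifying_comp (g f : discrete_topology G) : discrete_topology G :=
  ((g : G) * (f : G))%g.

Lemma classifying_comp_continuous
    (A : set (discrete_topology G * discrete_topology G)) :
  {within A, continuous (fun p => classifying_comp p.1 p.2)}.
Proof.
apply: continuous_subspaceT => -[g f] B /nbhs_singleton Bgf.
exists ([set g], [set f]); first by split; exact: discrete_set1.
by move=> [h e] /= [-> ->].
Qed.

Definition classifying_groupoid : topGroupoid :=
  @TopGroupoid (discrete_topology unit) (discrete_topology G)
    (fun=> tt) (fun=> tt) (fun=> 1%g) (fun g : G => g^-1%g) classifying_comp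
    (fun x => let: tt := x in erefl) (fun x => let: tt := x in erefl)
    (fun=> erefl) (fun=> erefl) (fun _ _ _ => erefl) (fun _ _ _ => erefl)
    (fun h g f _ _ => mulgA h g f)
    (@mul1g G) (@mulg1 G) (@mulVg G) (@mulgV G)
    (@discrete_continuous _ _ _) (@discrete_continuous _ _ _)
    (@discrete_continuous _ _ _) (@discrete_continuous _ _ _)
    (@classifying_comp_continuous _).

Context (sigma : G -> G) (sigmaM : {morph sigma : x y / (x * y)%g})
  (sigmaK : involutive sigma).

Let sigma1 : sigma 1%g = 1%g.
Proof. by apply: (mulgI (sigma 1%g)); rewrite -sigmaM !mulg1. Qed.

Definition classifying_involution : involution classifying_groupoid :=
  @Involution classifying_groupoid id sigma (fun=> erefl) sigmaK
    (fun=> erefl) (fun=> erefl) (fun=> sigma1) (fun g f _ => sigmaM g f)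
    (@discrete_continuous _ _ _) (@discrete_continuous _ _ _).

End classifying.

(* Main.v *)
(* A discrete space with n points has total cohomology of dimension n, because
   singular simplices are constant in it.  So the claim is that Gamma has at
   most as many twisted conjugacy classes x ~ sigma(g)^-1 x g (the fixed locus
   consists of those of the x with sigma(x) x = 1) as conjugacy classes.  By
   Burnside it suffices to compare fixed points: the x fixed by g under twisted
   conjugation are those with x g x^-1 = sigma(g), and these form either the
   empty set or a coset of the centraliser of g. *)

From HB Require Import structures.
Require Import Defs.
From mathcomp Require Import all_boot all_order all_algebra all_fingroup.

Set Implicit Arguments.
Unset Strict Implicit.
Unset Printing Implicit Defensive.

(** * Counting twisted conjugacy classes *)

Section twisted_conjugacy.
Context (gT : finGroupType) (sigma : gT -> gT)
  (sigmaM : {morph sigma : x y / (x * y)%g}).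
Local Open Scope group_scope.

(** The relation [psi * g = sigma g * phi] between fixed objects, solved for [phi]; this form is a
    right action of [g]. *)
Definition twisted_conj (x g : gT) : gT := (sigma g)^-1 * x * g.

Lemma twisted_conj1 : twisted_conj^~ 1 =1 id.
Proof.
have s1 : sigma 1 = 1 by apply: (mulgI (sigma 1)); rewrite -sigmaM !mulg1.
by move=> x; rewrite /twisted_conj s1 invg1 mul1g mulg1.
Qed.

Lemma twisted_conjM x : act_morph twisted_conj x.
Proof. by move=> g h; rewrite /twisted_conj sigmaM invMg !mulgA. Qed.

Definition twisted_action := TotalAction twisted_conj1 twisted_conjM.

Definition twisted_classes : {set {set gT}} :=
  [set orbit twisted_action [set: gT] x | x in [set: gT]].

Lemma leq_card_twisted_fix g :
  (#|'Fix_([set: gT] | twisted_action)[g]| <= #|'Fix_([set: gT] | 'J)[g]|)%N.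
Proof.
have [->|[x]] := set_0Vmem 'Fix_([set: gT] | twisted_action)[g].
  by rewrite cards0.
have fixE y :
    (y \in 'Fix_([set: gT] | twisted_action)[g]) = (y * g == sigma g * y).
  rewrite in_setI in_setT /=; apply/afix1P/eqP => /= [|yg].
    by rewrite /twisted_conj -mulgA => /(canRL (mulKVg _)).
  by rewrite /twisted_conj -mulgA yg mulKg.
(* If [x] and [y] both conjugate [g] to [sigma g], then [x^-1 * y] centralises [g]; left translation
   by [x^-1] is injective. *)
rewrite fixE => /eqP xg; rewrite -(card_imset _ (mulgI x^-1)).
apply/subset_leq_card/fintype.subsetP => _ /imsetP[y + ->].
rewrite fixE => /eqP yg; rewrite in_setI in_setT /=; apply/afix1P => /=.
apply/conjg_fixP/commgP/commute_sym; rewrite /commute -mulgA yg !mulgA.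
by congr (_ * _); rewrite -{1}(mulgK x (sigma g)) -xg !mulgA mulVg mul1g.
Qed.

Lemma leq_card_twisted_classes :
  (#|twisted_classes| <= #|classes [set: gT]|)%N.
Proof.
have clE : classes [set: gT] = [set orbit 'J [set: gT] x | x in [set: gT]].
  by apply: eq_imset => x; rewrite orbitJ.
have cT : (0 < #|[set: gT]|)%N by exact: (cardG_gt0 [set: gT]).
(* Times the group order, both sides become sums of fixed-point counts over [g]. *)
rewrite -(leq_pmul2r cT) clE.
have actsT (to : {action gT &-> gT}) : [acts [set: gT], on [set: gT] | to].
  apply/fintype.subsetP => g _; rewrite !inE.
  by apply/fintype.subsetP => x; rewrite !inE.
rewrite -(Frobenius_Cauchy (actsT 'J%act)).
rewrite -(Frobenius_Cauchy (actsT twisted_action)).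
by apply: leq_sum => g _; exact: leq_card_twisted_fix.
Qed.

End twisted_conjugacy.

(* Imported only here because the notations of classical sets hide those of
   finite sets. *)
From mathcomp Require Import generic_quotient.
From mathcomp Require Import all_classical all_reals all_analysis.

Import Order.TTheory GRing.Theory Num.Theory numFieldNormedType.Exports.

Local Open Scope classical_set_scope.
Local Open Scope ring_scope.
Local Open Scope quotient_scope.

(** * Discrete spaces *)

Definition all_open (X : topologicalType) := forall A : set X, open A.

Lemma all_open_subtype (X : topologicalType) (A : set X) :
  all_open X -> all_open A.
Proof.
move=> oX B; exists (val @` B) => //.
apply/seteqP; split=> [x [y By /val_inj <-]//|x Bx]; by exists x.
Qed.

Lemma all_open_prod (X Y : topologicalType) :
  all_open X -> all_open Y -> all_open (X * Y)%type.
Proof.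
move=> oX oY A; rewrite openE => -[x y] Axy.
exists ([set x], [set y]); first by split; exact: open_nbhs_nbhs.
by move=> [x' y'] /= [-> ->].
Qed.

Lemma all_open_quotient (X : topologicalType) (Q : quotType X) :
  all_open X -> all_open (quotient_topology Q).
Proof. by move=> oX A; exact: oX. Qed.

(** * Connectedness of the simplex *)

Section simplex_connected.
Context (R : realType) (n : nat).

(* The segment from [t] to [u], constant outside of [0 <= r <= 1] so that it is
   defined on the whole line. *)
Definition segment_map (t u : 'rV[R]_n.+1) (r : R) : 'rV[R]_n.+1 :=
  let c := Num.max 0 (Num.min 1 r) in (1 - c) *: t + c *: u.

Lemma segment_map_continuous t u : continuous (segment_map t u).
Proof.
have cC : continuous (fun r : R => Num.max 0 (Num.min 1 r)).
  move=> r; apply: continuous_max; first exact: cvg_cst.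
  by apply: continuous_min; [exact: cvg_cst|exact: cvg_id].
move=> r; apply: cvgD; apply: cvgZr_tmp; last exact: cC.
by apply: cvgB; [exact: cvg_cst|exact: cC].
Qed.

Lemma segment_map_simplex (t u : @simplex R n) r :
  @simplex R n (segment_map (val t) (val u) r).
Proof.
have [t0 t1] := set_mem (valP t); have [u0 u1] := set_mem (valP u).
rewrite /segment_map; set c := Num.max _ _.
have c0 : 0 <= c by rewrite le_max lexx.
have c1 : c <= 1 by rewrite ge_max ler01 ge_min lexx.
split=> [i|]; first by rewrite !mxE addr_ge0 // mulr_ge0 // subr_ge0.
under eq_bigr do rewrite !mxE.
by rewrite big_split -!mulr_sumr /= t1 u1 !mulr1 subrK.
Qed.

Definition simplex_path (t u : @simplex R n) r : @simplex R n :=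
  SigSub (mem_set (segment_map_simplex t u r)).

Lemma simplex_path_continuous t u : continuous (simplex_path t u).
Proof.
apply/continuousP => _ [B oB <-].
by move/continuousP: (@segment_map_continuous (val t) (val u)); apply.
Qed.

Lemma simplex_path0 t u : simplex_path t u 0 = t.
Proof.
apply/val_inj; rewrite /= /segment_map min_r // maxxx subr0 scale1r scale0r.
by rewrite addr0.
Qed.

Lemma simplex_path1 t u : simplex_path t u 1 = u.
Proof.
apply/val_inj; rewrite /= /segment_map minxx max_r // subrr scale1r scale0r.
by rewrite add0r.
Qed.

Lemma simplex_to_discrete_const (X : topologicalType) (s : @simplex R n -> X)
    t u :
  all_open X -> continuous s -> s t = s u.
Proof.
move=> oX cs.
have cf : continuous (s \o simplex_path t u).
  by move=> r; apply: continuous_comp;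
    [exact: simplex_path_continuous|exact: cs].
have cT : connected [set: R] by apply/connected_intervalP.
(* [A] is open and closed and contains 0, so it is the whole connected line and contains 1. *)
pose A := [set r | s (simplex_path t u r) = s t].
have -> // : s u = s t.
rewrite -[in LHS](simplex_path1 t u); suff: A 1 by [].
suff -> : A = setT by [].
apply: cT; first by exists 0; rewrite /A /= simplex_path0.
  exists A; rewrite ?setTI //.
  by move/continuousP: cf => /(_ [set s t]); exact.
exists A; rewrite ?setTI //.
move/continuous_closedP: cf => /(_ [set s t]); apply.
by rewrite -openC; exact: oX.
Qed.

Lemma simplex_point : {t : @simplex R n | True}.
Proof.
apply: cid; have H : @simplex R n (delta_mx 0 0).
  split=> [i|]; first by rewrite mxE ler0n.
  rewrite (bigD1 ord0) //= big1 => [|i i0]; rewrite !mxE ?eqxx ?addr0//.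
  by rewrite (negbTE i0).
by exists (SigSub (mem_set H)).
Qed.

End simplex_connected.

(** * The quotient map of modules as a linear map *)

Section quot_proj.
Context {k : fieldType} {V : lmodType k} (W : submodClosed V).

Definition quot_proj (v : V) : quot_module W := \pi_(quot_module W) v.

Lemma quot_proj_linear : linear quot_proj.
Proof. by move=> a u v; rewrite /quot_proj pi_quot_add pi_quot_scale. Qed.

HB.instance Definition _ :=
  GRing.isLinear.Build k V (quot_module W) _ quot_proj quot_proj_linear.

Lemma quot_proj_eq0 v : (quot_proj v == 0) = (v \in W).
Proof.
rewrite -[X in _ == X](raddf0 quot_proj).
by rewrite /quot_proj -Quotient.idealrBE subr0.
Qed.

Lemma quot_proj_surj (h : quot_module W) : exists v, h = quot_proj v.
Proof. by exists (repr h); rewrite /quot_proj reprK. Qed.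

End quot_proj.
Arguments quot_proj {k V W}.

Lemma sum_signr (k : pzRingType) n :
  \sum_(i < n) (-1) ^+ i = (odd n)%:R :> k.
Proof.
elim: n => [|n IHn]; first by rewrite big_ord0.
rewrite big_ord_recr /= IHn -signr_odd; case: (odd n) => /=.
  by rewrite expr1 subrr.
by rewrite expr0 add0r.
Qed.

(** * Cohomology of a discrete space *)

Section discrete_cohomology.
Context (R : realType) (k : fieldType) (X : topologicalType)
  (oX : all_open X).

Definition const_simplex n (x : X) : singular_simplex R X n :=
  (cst x : continuousType _ _).

Definition simplex_value n (s : singular_simplex R X n) : X :=
  s (sval (simplex_point R n)).

Lemma const_simplexK n : cancel (@const_simplex n) (@simplex_value n).
Proof. by []. Qed.

Lemma simplex_valueK n : cancel (@simplex_value n) (@const_simplex n).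
Proof.
move=> s; apply/continuousEP => t; rewrite /= /simplex_value.
exact: (simplex_to_discrete_const _ _ oX (@cts_fun _ _ s)).
Qed.

(** All faces of a constant simplex are constant with the same value, so only the alternating sum of
    signs remains: the coboundaries are alternately zero and bijective. *)
Lemma coboundary_discrete n (c : cochain R k X n)
    (s : singular_simplex R X n.+1) :
  coboundary c s = (odd n)%:R * c (const_simplex n (simplex_value s)).
Proof.
rewrite /coboundary -{1}[s]simplex_valueK.
(* There are [n.+2] faces, as many as the signs to be summed. *)
have -> : (odd n)%:R = (odd n.+2)%:R :> k by rewrite /= negbK.
rewrite -sum_signr mulr_suml; apply: eq_bigr => i _; congr (_ * c _).
exact/continuousEP.
Qed.

Lemma cocycle_even n (c : cochain R k X n) :
  ~~ odd n -> c \in @is_cocycle R k X n.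
Proof.
move=> n_even; apply/eqP/funext => s.
by rewrite coboundary_discrete (negbTE n_even) mul0r.
Qed.

Lemma singular_cohomology_discrete_eq0 n
    (h : singular_cohomology R k X n.+1) :
  h = 0.
Proof.
have [c ->] := quot_proj_surj h; have /eqP c0 := cocycle_valP c.
apply/eqP; rewrite quot_proj_eq0; apply/asboolP => /=.
have [n_odd|n_even] := boolP (odd n).
  (* The incoming coboundary is bijective; the primitive is [c] itself, moved down one degree. *)
  exists (fun s => val c (const_simplex n.+1 (simplex_value s))).
  apply/funext => s; rewrite coboundary_discrete n_odd mul1r.
  by rewrite const_simplexK simplex_valueK.
(* The outgoing coboundary is injective, so the cocycle [c] vanishes. *)
exists 0; rewrite raddf0; apply/funext => s.
rewrite -[s]simplex_valueK.
move/(congr1 (fun d => d (const_simplex n.+2 (simplex_value s)))): c0.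
by rewrite coboundary_discrete const_simplexK /= n_even mul1r.
Qed.

Definition dirac_cochain (x : X) : cochain R k X 0 :=
  fun s => (simplex_value s == x)%:R.

Definition dirac_cocycle x : cocycle R k X 0 :=
  Cocycle (cocycle_even (dirac_cochain x) isT).

Definition dirac_class_seq x : direct_prod (singular_cohomology R k X) :=
  fun i => if i is 0%N then quot_proj (dirac_cocycle x) else 0.

Lemma dirac_class_seq_finite x :
  dirac_class_seq x \in @Defs.finite_support _ _.
Proof. by apply/asboolP; exists 1%N; case. Qed.

Definition dirac_class x : total_cohomology R k X :=
  DirectSum (dirac_class_seq_finite x).

Lemma dirac_class_sum n (e : 'I_n -> X) (a : 'I_n -> k) :
  val (\sum_i a i *: dirac_class (e i)) 0%N =
  quot_proj (\sum_i a i *: dirac_cocycle (e i)).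
Proof.
rewrite [RHS]linear_sum.
apply: (big_ind2 (fun (u : total_cohomology R k X) y => val u 0%N = y)) => //.
  by move=> u1 y1 u2 y2 <- <-.
by move=> i _; rewrite [RHS]linearZ.
Qed.

Lemma dirac_cocycle_sum n (e : 'I_n -> X) (a : 'I_n -> k) s :
  val (\sum_i a i *: dirac_cocycle (e i)) s =
  \sum_i a i * (simplex_value s == e i)%:R.
Proof.
apply: (big_ind2 (fun (u : cocycle R k X 0) y => val u s = y)) => //.
by move=> u1 y1 u2 y2 <- <-.
Qed.

(** Only degree 0 survives, where the sole coboundary is 0 and a class is a function on the points;
    evaluation at [e j] extracts the [j]-th coefficient. *)
Lemma total_cohomology_basis n (e : 'I_n -> X) :
  bijective e -> is_basis (dirac_class \o e).
Proof.
move=> [e' eK e'K].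
have sumE a j :
    val (\sum_i a i *: dirac_cocycle (e i)) (const_simplex 0 (e j)) = a j.
  rewrite dirac_cocycle_sum const_simplexK (bigD1 j) //= eqxx mulr1.
  rewrite big1 ?addr0 // => i ij.
  by rewrite (can_eq eK) eq_sym (negbTE ij) mulr0.
split=> [a a0 j|v].
  have := dirac_class_sum e a; rewrite a0 => /esym/eqP.
  by rewrite quot_proj_eq0 => /eqP c0; rewrite -(sumE a j) c0.
have [c vc] := quot_proj_surj (val v 0%N).
exists (fun i => val c (const_simplex 0 (e i))).
apply/val_inj/functional_extensionality_dep => -[|i]; last first.
  rewrite [RHS]singular_cohomology_discrete_eq0.
  exact: singular_cohomology_discrete_eq0.
rewrite [LHS]vc dirac_class_sum; congr quot_proj.
apply/val_inj/funext => s; rewrite -[s]simplex_valueK -[simplex_value s]e'K.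
by rewrite sumE.
Qed.

End discrete_cohomology.

(** * Comparing dimensions and counting points *)

(** [b] bounds the first infimum above by [n]; by [leq_basis] every finite basis of [W] has at least
    [m] elements. *)
Lemma le_vdim (R : realType) (k : fieldType) (V W : lmodType k) n m
    (b : 'I_n -> V) (c : 'I_m -> W) :
  is_basis b -> is_basis c -> (n <= m)%N -> (vdim R V <= vdim R W)%E.
Proof.
move=> bb cb nm; apply: (@le_trans _ _ n%:R%:E).
  by apply: ereal_inf_lbound; exists n => //; exists b.
apply/ereal_infP => _ [p [d db] <-]; rewrite lee_fin ler_nat.
exact: leq_trans nm (leq_basis cb db).
Qed.

(** Counts the points of a quotient space through an injective invariant with values in a finite
    type. *)
Lemma injective_enum (X : choiceType) (T : finType) (f : X -> T) :
  injective f ->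
  exists e : 'I_#|[set t : T | `[< exists x, f x = t >]]%SET| -> X,
    bijective e.
Proof.
move=> f_inj; set A := [set t : T | _]%SET.
have fA x : f x \in A by rewrite inE; apply/asboolP; exists x.
have ex (i : 'I_#|A|) : exists x, f x = enum_val i.
  by have := enum_valP i; rewrite inE => /asboolP.
exists (fun i => projT1 (cid (ex i))).
exists (fun x => enum_rank_in (fA x) (f x)) => [i|x].
  by apply: enum_val_inj; rewrite enum_rankK_in //; exact: projT2 (cid (ex i)).
by case: cid => y /= fy; apply: f_inj; rewrite fy enum_rankK_in.
Qed.

(** * Points of the two quotient spaces as classes in the group *)

Section classifying_orbits.
Context (gT : finGroupType) (sigma : gT -> gT)
  (sigmaM : {morph sigma : x y / (x * y)%g}) (sigmaK : involutive sigma).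
Let B := classifying_groupoid gT.
Let s := classifying_involution sigmaM sigmaK.

Lemma all_open_fixed_locus : all_open (fixed_locus s).
Proof.
apply: all_open_quotient; apply: all_open_subtype; apply: all_open_prod;
  by move=> A; exact: discrete_open.
Qed.

Lemma all_open_inertia_space : all_open (inertia_space B).
Proof.
apply: all_open_quotient; apply: all_open_subtype => A; exact: discrete_open.
Qed.

Definition fixed_repr (x : fixed_locus s) : fixed_objects s :=
  repr (x : {eq_quot fixed_iso (s := s)}).

Definition fixed_orbit (x : fixed_locus s) : {set gT} :=
  orbit (twisted_action sigmaM) [set: gT]%SET (val (fixed_repr x)).2.

(** An element [g] moving one representative to the other is itself the required arrow. The map need
    not reach all twisted classes, as only [x] with [sigma x * x = 1] occur. *)
Lemma fixed_orbit_inj : injective fixed_orbit.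
Proof.
move=> x y /eqP; rewrite orbit_eq_mem => /orbitP[g _ /= gxy].
have fixedK z : \pi_{eq_quot fixed_iso (s := s)} (fixed_repr z) = z.
  by rewrite reprK.
rewrite -(fixedK x) -(fixedK y); apply/eqmodP/asboolP; exists g; split.
- by case: (gsrc _); case: (_.1).
- by case: (gtgt _); case: (_.1).
by rewrite /= -gxy /twisted_conj /classifying_comp !mulgA mulgV mul1g.
Qed.

Definition inertia_repr (x : inertia_space B) : @inertia_objects B :=
  repr (x : {eq_quot inertia_iso (X := B)}).

Lemma inertia_reprK x :
  \pi_{eq_quot inertia_iso (X := B)} (inertia_repr x) = x.
Proof. by rewrite reprK. Qed.

Definition inertia_class (x : inertia_space B) : {set gT} :=
  ((val (inertia_repr x) : gT) ^: [set: gT]%SET)%g.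

Lemma inertia_class_inj : injective inertia_class.
Proof.
move=> x y xy.
have /imsetP[g _ gxy] : val (inertia_repr x) \in inertia_class y.
  by rewrite -xy; exact: class_refl.
rewrite -(inertia_reprK x) -(inertia_reprK y).
apply/eqmodP/asboolP; exists g; split.
- by case: (gsrc _); case: (gsrc _).
- by case: (gtgt _); case: (gsrc _).
by rewrite /= gxy /classifying_comp -conjgC.
Qed.

(** Every arrow of a one-object groupoid is a loop, so each group element is an inertia object,
    conjugate to the chosen representative of its point. *)
Lemma inertia_class_surj C :
  C \in classes [set: gT]%SET -> exists x, inertia_class x = C.
Proof.
move=> /imsetP[g _ ->].
have gI : @inertia_objects B g by [].
pose x := \pi_{eq_quot inertia_iso (X := B)} (SigSub (mem_set gI)).
have /eqmodP/asboolP[f [_ _ /= gf]] := inertia_reprK x.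
exists x; apply/class_eqP/imsetP; exists f; rewrite ?inE //.
by rewrite conjgE [X in (_ * X)%g]gf mulKg.
Qed.

End classifying_orbits.

Theorem proposition1p8 (R : realType) (Gamma : finGroupType)
    (sigma : Gamma -> Gamma)
    (sigmaM : {morph sigma : x y / (x * y)%g >-> (x * y)%g})
    (sigmaK : involutive sigma) :
  (vdim R (total_cohomology R 'F_2
             (fixed_locus (classifying_involution sigmaM sigmaK)))
   <= vdim R (total_cohomology R 'F_2
                (inertia_space (classifying_groupoid Gamma))))%E.
Proof.
have [e eK] := injective_enum (@fixed_orbit_inj _ _ sigmaM sigmaK).
have [e' e'K] := injective_enum (@inertia_class_inj Gamma).
have oF := @all_open_fixed_locus _ _ sigmaM sigmaK.
have oI := @all_open_inertia_space Gamma.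
apply: (le_vdim R (total_cohomology_basis R 'F_2 oF eK)
  (total_cohomology_basis R 'F_2 oI e'K)).
(* Points of the fixed locus inject into the twisted classes; every conjugacy class comes from a
   point of the inertia space. *)
apply: (@leq_trans #|twisted_classes sigmaM|).
  apply/subset_leq_card/fintype.subsetP => t; rewrite inE => /asboolP[x <-].
  exact: imset_f.
apply: leq_trans (leq_card_twisted_classes sigmaM) _.
apply/subset_leq_card/fintype.subsetP => C /inertia_class_surj[x <-].
by rewrite inE; apply/asboolP; exists x.
Qed.
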